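(* For closure spaces $A$ and $B$, the following conditions are equivalent: (a) $A$ and $B$ are polarized, or one of them has only one closed set. (b) The complete lattices $\mathcal{C}A$ and $\mathcal{C}B$ are pseudocomplemented, or one of them is a singleton. (c) The (mutually isomorphic) lattices $\check A\otimes\check B\simeq A\otimes B\simeq\mathcal{C}A\otimes\mathcal{C}B$ are pseudocomplemented.
   Context: A closure space $A$ is a set $\mathcal{U}A$ with a collection $\mathcal{C}A$ of subsets (''closed sets'') closed under arbitrary intersections (including $\bigcap\emptyset=\mathcal{U}A$); $\mathcal{C}A$ is a complete lattice under inclusion. $\overline{X}$ is the least closed set containing $X$, $\overline{x}=\overline{\{x\}}$, $\bot_A=\overline{\emptyset}$. $A$ is polarized if for each $x\in\mathcal{U}A$ the set $x^{\perp}=\{y\in\mathcal{U}A:\overline{x}\cap\overline{y}=\overline{\emptyset}\}$ is closed. $\check A$ is the subspace of $A$ on $\mathcal{U}A\setminus\bot_A$ (closed sets: $C\setminus\bot_A$, $C\in\mathcal{C}A$). A complete lattice is pseudocomplemented if for each $x$ there is a greatest $y$ with $x\wedge y=0$. For closure spaces $A,B$, $A\otimes B$ is the set, ordered by inclusion, of all $T\subseteq\mathcal{U}A\times\mathcal{U}B$ such that each $\{y:(x,y)\in T\}$ ($x\in\mathcal{U}A$) is closed in $B$ and each $\{x:(x,y)\in T\}$ ($y\in\mathcal{U}B$) is closed in $A$; it is a complete lattice. A complete lattice, such as $\mathcal{C}A$, is regarded as a closure space whose closed sets are its principal ideals; so $\mathcal{C}A\otimes\mathcal{C}B$ is the set of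 all $T\subseteq\mathcal{C}A\times\mathcal{C}B$ all of whose slices $\{G:(F,G)\in T\}$ and $\{F:(F,G)\in T\}$ are principal ideals. *)

(* Defs.v *)
From HB Require Import structures.
From mathcomp Require Import all_boot all_order.
From mathcomp Require Import boolp classical_sets.

Set Implicit Arguments.
Unset Strict Implicit.
Unset Printing Implicit Defensive.

Import Order.TTheory.

Local Open Scope classical_set_scope.

HB.mixin Record isCompleteLattice d T of Order.TBLattice d T := {
  infimums_exist : forall S : set T, infimums S !=set0;
  supremums_exist : forall S : set T, supremums S !=set0
}.

#[short(type="completeLatticeType")]
HB.structure Definition CompleteLattice d :=
  {T of Order.TBLattice d T & isCompleteLattice d T}.

Definition pseudocomplemented d (L : completeLatticeType d) : Prop :=
  forall x : L, exists y : L,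
    (x `&` y = \bot)%O /\ forall z : L, (x `&` z = \bot)%O -> (z <= y)%O.

Definition is_singleton d (L : completeLatticeType d) : Prop :=
  exists x : L, forall y : L, y = x.

Definition lattice_iso d1 d2
    (L : completeLatticeType d1) (M : completeLatticeType d2) : Prop :=
  exists f : L -> M, bijective f /\ {mono f : x y / (x <= y)%O}.

(* The empty family D accounts for the whole space being closed. *)
Record closureSpace := ClosureSpace {
  points :> Type;
  closed_sets : set (set points);
  closed_bigcap : forall D : set (set points),
    D `<=` closed_sets -> closed_sets (\bigcap_(X in D) X)
}.
Arguments closed_sets : clear implicits.

Definition closure (A : closureSpace) (X : set A) : set A :=
  \bigcap_(C in [set C | closed_sets A C /\ X `<=` C]) C.

Definition bottom (A : closureSpace) : set A := closure set0.
Arguments bottom : clear implicits.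

Definition perp (A : closureSpace) (x : A) : set A :=
  [set y | closure [set x] `&` closure [set y] = closure set0].

Definition polarized (A : closureSpace) : Prop :=
  forall x : A, closed_sets A (perp x).

Definition one_closed_set (A : closureSpace) : Prop :=
  exists C : set A, closed_sets A = [set C].

Section ClosureSpaceTheory.
Variable A : closureSpace.
Implicit Types X Y C : set A.

Lemma closed_setT : closed_sets A [set: A].
Proof. by rewrite -(bigcap_set0 id); apply: closed_bigcap. Qed.

Lemma closed_setI X Y :
  closed_sets A X -> closed_sets A Y -> closed_sets A (X `&` Y).
Proof.
move=> cX cY; have -> : X `&` Y = \bigcap_(Z in [set Z | Z = X \/ Z = Y]) Z.
  apply/seteqP; split=> [x [Xx Yx] Z [->|->] //|x XYx].
  by split; apply: XYx; [left|right].
by apply: closed_bigcap => Z [->|->].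
Qed.

Lemma closure_closed X : closed_sets A (closure X).
Proof. by apply: closed_bigcap => C []. Qed.

Lemma sub_closure X : X `<=` closure X.
Proof. by move=> x Xx C [_]; apply. Qed.

Lemma closure_min X C : closed_sets A C -> X `<=` C -> closure X `<=` C.
Proof. by move=> cC XC x; apply. Qed.

End ClosureSpaceTheory.

Definition closed_lattice (A : closureSpace) : Type :=
  set_type (closed_sets A).

Section ClosedLattice.
Variable A : closureSpace.

HB.instance Definition _ := SubChoice.on (closed_lattice A).
HB.instance Definition _ :=
  [SubChoice_isSubPOrder of closed_lattice A by <: with set_display].

Implicit Types X Y Z : closed_lattice A.

Lemma closed_latticeP X : closed_sets A (val X).
Proof. exact: set_mem (valP X). Qed.

Lemma closed_latticeE X Y : (X <= Y)%O = (val X `<=` val Y) :> Prop.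
Proof. by rewrite -subsetEset. Qed.

Definition to_closed (C : set A) (cC : closed_sets A C) : closed_lattice A :=
  exist (fun C => C \in closed_sets A) C (mem_set cC).

Definition closed_meet X Y : closed_lattice A :=
  to_closed (closed_setI (closed_latticeP X) (closed_latticeP Y)).

Definition closed_closure (S : set A) : closed_lattice A :=
  to_closed (closure_closed S).

Definition closed_join X Y : closed_lattice A :=
  closed_closure (val X `|` val Y).

Lemma closed_meetP X Y Z :
  (X <= closed_meet Y Z)%O = (X <= Y)%O && (X <= Z)%O.
Proof.
by apply/idP/andP; rewrite !closed_latticeE /= subsetI.
Qed.

Lemma closed_joinP X Y Z :
  (closed_join X Y <= Z)%O = (X <= Z)%O && (Y <= Z)%O.
Proof.
apply/idP/andP; rewrite !closed_latticeE.
  rewrite -subUset; apply: subset_trans; exact: sub_closure.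
move=> [XZ YZ].
by apply: closure_min; [exact: closed_latticeP|rewrite subUset].
Qed.

HB.instance Definition _ := Order.POrder_MeetJoin_isLattice.Build
  set_display (closed_lattice A) closed_meetP closed_joinP.

Lemma closed_le_bot X : (closed_closure set0 <= X)%O.
Proof.
by rewrite closed_latticeE; apply: closure_min => //; exact: closed_latticeP.
Qed.

Lemma closed_le_top X : (X <= to_closed (closed_setT A))%O.
Proof. by rewrite closed_latticeE. Qed.

HB.instance Definition _ :=
  Order.hasBottom.Build set_display (closed_lattice A) closed_le_bot.
HB.instance Definition _ :=
  Order.hasTop.Build set_display (closed_lattice A) closed_le_top.

Lemma closed_infimums (S : set (closed_lattice A)) : infimums S !=set0.
Proof.
have cS : closed_sets A (\bigcap_(X in val @` S) X).
  by apply: closed_bigcap => _ [X _ <-]; exact: closed_latticeP.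
exists (to_closed cS); split=> X SX; rewrite closed_latticeE /=.
  by apply: bigcap_inf; exists X.
by apply: sub_bigcap => _ [Y SY <-]; rewrite -closed_latticeE; apply: SX.
Qed.

Lemma closed_supremums (S : set (closed_lattice A)) : supremums S !=set0.
Proof.
exists (closed_closure (\bigcup_(X in val @` S) X)).
split=> X SX; rewrite closed_latticeE /=.
  apply: subset_trans (@sub_closure _ _) => x Xx.
  by exists (val X) => //; exists X.
apply: closure_min; first exact: closed_latticeP.
by apply: bigcup_sub => _ [Y SY <-]; rewrite -closed_latticeE; apply: SX.
Qed.

HB.instance Definition _ := isCompleteLattice.Build
  set_display (closed_lattice A) closed_infimums closed_supremums.

End ClosedLattice.

Section Subspace.
Variables (A : closureSpace) (S : set A).

Definition subspace_closed : set (set S) :=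
  [set X | exists2 C, closed_sets A C & X = val @^-1` C].

Lemma subspace_closed_bigcap (D : set (set S)) :
  D `<=` subspace_closed -> subspace_closed (\bigcap_(X in D) X).
Proof.
move=> cD.
exists (\bigcap_(C in [set C | closed_sets A C /\ D (val @^-1` C)]) C).
  by apply: closed_bigcap => C [].
apply/seteqP; split=> [x DX C [_ /DX] //|x DX X DX'].
have [C cC XC] := cD X DX'; rewrite XC; apply: DX.
by split=> //; rewrite -XC.
Qed.

Definition subspace : closureSpace := ClosureSpace subspace_closed_bigcap.

End Subspace.

Definition check (A : closureSpace) : closureSpace := subspace (~` bottom A).

Section PrincipalIdeals.
Variables (d : Order.disp_t) (L : completeLatticeType d).

Definition principal_ideals : set (set L) :=
  [set X | exists a : L, X = [set b | (b <= a)%O]].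

Lemma principal_ideals_bigcap (D : set (set L)) :
  D `<=` principal_ideals -> principal_ideals (\bigcap_(X in D) X).
Proof.
move=> pD.
have [m [lb_m glb_m]] :=
  infimums_exist [set a : L | D [set b | (b <= a)%O]].
exists m; apply/seteqP; split=> [x Dx|x xm X DX].
  by apply: glb_m => a Da; exact: (Dx _ Da).
have [a Xa] := pD X DX; rewrite Xa /=; apply: le_trans xm (lb_m _ _).
by rewrite /= -Xa.
Qed.

Definition ideal_space : closureSpace := ClosureSpace principal_ideals_bigcap.

End PrincipalIdeals.

(* The family of sets defining the tensor product is itself stable under
   intersection, so the tensor product is obtained as the complete lattice of
   closed sets of a closure space on the pairs. *)
Section Tensor.
Variables A B : closureSpace.

Definition tensor_sets : set (set (A * B)) :=
  [set T | (forall x : A, closed_sets B [set y | T (x, y)]) /\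
           (forall y : B, closed_sets A [set x | T (x, y)])].

Lemma tensor_sets_bigcap (D : set (set (A * B))) :
  D `<=` tensor_sets -> tensor_sets (\bigcap_(T in D) T).
Proof.
move=> tD; split=> [x|y].
  have -> : [set y | (\bigcap_(T in D) T) (x, y)] =
      \bigcap_(Y in [set [set y | T (x, y)] | T in D]) Y.
    apply/seteqP; split=> [y DT _ [T DT' <-]|y DT T DT']; first exact: DT.
    by apply: (DT [set y | T (x, y)]); exists T.
  by apply: closed_bigcap => _ [T /tD[cT _] <-]; exact: cT.
have -> : [set x | (\bigcap_(T in D) T) (x, y)] =
    \bigcap_(X in [set [set x | T (x, y)] | T in D]) X.
  apply/seteqP; split=> [x DT _ [T DT' <-]|x DT T DT']; first exact: DT.
  by apply: (DT [set x | T (x, y)]); exists T.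
by apply: closed_bigcap => _ [T /tD[_ cT] <-]; exact: cT.
Qed.

Definition tensor_space : closureSpace := ClosureSpace tensor_sets_bigcap.

Definition tensor : completeLatticeType set_display :=
  closed_lattice tensor_space.

End Tensor.

(* Main.v *)
Require Import Defs.
From mathcomp Require Import all_boot all_order.
From mathcomp Require Import boolp classical_sets.

(** For a single closure space, being polarized is the pointwise form of
    having a pseudocomplemented lattice of closed sets: the pseudocomplement of
    the closure of [x] can only be the perp of [x], and conversely the
    pseudocomplement of a closed set is the intersection of the perps of its
    points ([pseudocomplemented_closed_lattice]).  As the tensor product is
    itself the lattice of closed sets of a closure space on the pairs, the
    theorem reduces to a statement about perps of pairs.

    Every member of the tensor product contains the cross of the pairs having
    a coordinate in the bottom, and the cross is itself a member; and the
    member generated by [(a, b)] is the cross together with the rectangle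
    spanned by the closures of [a] and [b].  Two such rectangles meet inside
    the cross exactly when their first sides meet inside the bottom of [A] or
    their second sides meet inside the bottom of [B], whence

      [(x, y)] is in the perp of [(a, b)] iff
        [x] is in the perp of [a] or [y] is in the perp of [b]

    ([perp_tensor]).  A slice of this set is either everything or a perp in one
    factor, so polarization of both factors gives that of the tensor product.
    Conversely the slice at a point [b] outside the bottom is the perp of [a],
    because such a [b] is not in its own perp; a point of this kind exists
    unless [B] has only one closed set.  If one of the factors has only one
    closed set, its bottom is everything, hence so is the cross, and the tensor
    product has a single member.

    For the isomorphisms, the cross is the information that deleting the
    bottoms forgets, and it is the same for all members; and a member [T] of
    the tensor product is determined by the rectangles [F * G] of closed sets
    that it contains, since with a pair [(x, y)] it contains the product of
    their closures. *)

Set Implicit Arguments.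
Unset Strict Implicit.
Unset Printing Implicit Defensive.

Import Order.TTheory.

Local Open Scope classical_set_scope.

Local Notation closure := Defs.closure.
Local Notation closure_closed := Defs.closure_closed.

(** * Isomorphisms of complete lattices *)

Section LatticeIso.
Variables (d1 d2 : Order.disp_t).
Variables (L : completeLatticeType d1) (M : completeLatticeType d2).

Lemma lattice_iso_cancel (f : L -> M) (g : M -> L) :
  cancel f g -> cancel g f ->
  {homo f : x y / (x <= y)%O} -> {homo g : x y / (x <= y)%O} ->
  lattice_iso L M.
Proof.
move=> fK gK fm gm; exists f; split; first by exists g.
by move=> x y; apply/idP/idP => [/gm|/fm //]; rewrite !fK.
Qed.

Lemma lattice_iso_sym : lattice_iso L M -> lattice_iso M L.
Proof.
move=> [f [[g fK gK] fm]]; exists g; split; first by exists f.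
by move=> x y; rewrite -fm !gK.
Qed.

Lemma pseudocomplemented_iso :
  lattice_iso L M -> pseudocomplemented L -> pseudocomplemented M.
Proof.
move=> [f [[g fK gK] fm]] pL.
have fmeet x y : f (x `&` y)%O = (f x `&` f y)%O.
  apply/le_anti; rewrite lexI !fm leIl leIr /=.
  rewrite -[X in (X <= _)%O]gK fm lexI -!fm gK.
  by rewrite leIl leIr.
have fbot : f \bot%O = \bot%O.
  by apply/le_anti; rewrite le0x andbT -[X in (_ <= X)%O]gK fm le0x.
move=> x; have [y [xy0 ymax]] := pL (g x).
exists (f y); split; first by rewrite -{1}(gK x) -fmeet xy0.
move=> z xz0; rewrite -(gK z) fm; apply: ymax.
by apply: (can_inj fK); rewrite fmeet !gK xz0 fbot.
Qed.

End LatticeIso.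

(** * Pseudocomplements and perps in a closure space *)

Section ClosureSpaces.
Variable A : closureSpace.
Implicit Types (x y : A) (X : set A).

Lemma bottom_sub X : closed_sets A X -> bottom A `<=` X.
Proof. by move=> cX; exact: closure_min. Qed.

Lemma closure1_sub x X : closed_sets A X -> X x -> closure [set x] `<=` X.
Proof. by move=> cX Xx; apply: closure_min => // _ ->. Qed.

Lemma mem_closure1 x : closure [set x] x.
Proof. exact: sub_closure. Qed.

Lemma perpE x y :
  perp x y <-> closure [set x] `&` closure [set y] `<=` bottom A.
Proof.
split=> [->//|xy0]; apply/seteqP; split=> //.
by apply: bottom_sub; apply: closed_setI; exact: closure_closed.
Qed.

Lemma perpxx x : perp x x <-> bottom A x.
Proof.
rewrite perpE setIid; split=> [|bx]; first by apply; exact: mem_closure1.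
by apply: closure1_sub => //; exact: closure_closed.
Qed.

Lemma closed_meet_bot (X Y : closed_lattice A) :
  (X `&` Y = \bot)%O <-> val X `&` val Y `<=` bottom A.
Proof.
split=> [XY0|XY0]; first by rewrite -[_ `&` _]/(val (X `&` Y)%O) XY0.
by apply/le_anti; rewrite le0x andbT closed_latticeE.
Qed.

Lemma pseudocomplemented_closed_lattice :
  pseudocomplemented (closed_lattice A) <-> polarized A.
Proof.
split=> [pA x|pA X].
  have [Y [/closed_meet_bot xY0 Ymax]] := pA (closed_closure [set x]).
  suff -> : perp x = val Y by exact: closed_latticeP.
  apply/seteqP; split=> [y /perpE xy0|y Yy].
    have : (closed_closure [set y] <= Y)%O by exact/Ymax/closed_meet_bot.
    by rewrite closed_latticeE; apply; exact: mem_closure1.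
  apply/perpE => z [xz yz]; apply: xY0; split=> //.
  by apply: closure1_sub Yy _ yz; exact: closed_latticeP.
have cX : closed_sets A (\bigcap_(Y in [set perp x | x in val X]) Y).
  by apply: closed_bigcap => _ [x _ <-]; exact: pA.
exists (to_closed cX); split.
  apply/closed_meet_bot => x [Xx Xpx]; apply/perpxx.
  by apply: (Xpx (perp x)); exists x.
move=> Y /closed_meet_bot XY0; rewrite closed_latticeE => y Yy _ [x Xx <-].
apply/perpE => z [xz yz]; apply: XY0.
split; [apply: closure1_sub Xx _ xz|apply: closure1_sub Yy _ yz];
  exact: closed_latticeP.
Qed.

Lemma one_closed_setE : one_closed_set A <-> bottom A = [set: A].
Proof.
split=> [[C cC]|b1].
  have /= CT := @closed_setT A; have Cb := @closure_closed A set0.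
  by rewrite cC in CT Cb; rewrite CT.
exists [set: A]; apply/seteqP; split=> [X cX|_ ->]; last exact: closed_setT.
by apply/seteqP; split=> // x _; apply: (bottom_sub cX); rewrite b1.
Qed.

Lemma is_singleton_closed_lattice :
  is_singleton (closed_lattice A) <-> one_closed_set A.
Proof.
rewrite one_closed_setE; split=> [[X sX]|b1].
  rewrite -[LHS]/(val (\bot%O : closed_lattice A)).
  by rewrite -[RHS]/(val (\top%O : closed_lattice A)) (sX \bot%O) (sX \top%O).
exists \bot%O => X; apply/le_anti; rewrite le0x andbT closed_latticeE.
by move=> x _; rewrite -[val _]/(bottom A) b1.
Qed.

End ClosureSpaces.

(** * The perp of a pair *)

Section TensorPerp.
Variables A B : closureSpace.
Implicit Types (a x : A) (b y : B) (T : set (A * B)).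

Definition cross : set (A * B) := [set p | bottom A p.1 \/ bottom B p.2].

Lemma cross_sub T : tensor_sets T -> cross `<=` T.
Proof.
move=> [cT1 cT2] [x y] [/= bx|/= bY].
  exact: (bottom_sub (cT2 y) bx).
exact: (bottom_sub (cT1 x) bY).
Qed.

(** The union of the cross with the rectangle is closed because its slices are
    the whole space, the given closed set, or the bottom, according to the
    position of the fixed coordinate. *)
Lemma tensor_rectangle (F : set A) (G : set B) :
  closed_sets A F -> closed_sets B G -> tensor_sets (cross `|` F `*` G).
Proof.
move=> cF cG; split=> [x|y].
  have [bx|nbx] := pselect (bottom A x).
    rewrite (_ : mkset _ = setT); first exact: closed_setT.
    by apply/seteqP; split=> // y _; left; left.
  have [Fx|nFx] := pselect (F x).
    rewrite (_ : mkset _ = G) //; apply/seteqP; split=> [y|y Gy]; last by right.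
    by case=> [[//|/(bottom_sub cG)]|[]].
  rewrite (_ : mkset _ = bottom B); first exact: closure_closed.
  by apply/seteqP; split=> [y [[]|[]] //|y bY]; left; right.
have [bY|nby] := pselect (bottom B y).
  rewrite (_ : mkset _ = setT); first exact: closed_setT.
  by apply/seteqP; split=> // x _; left; right.
have [Gy|nGy] := pselect (G y).
  rewrite (_ : mkset _ = F) //; apply/seteqP; split=> [x|x Fx]; last by right.
  by case=> [[/(bottom_sub cF)|//]|[]].
rewrite (_ : mkset _ = bottom A); first exact: closure_closed.
by apply/seteqP; split=> [x [[]|[]] //|x bx]; left; left.
Qed.

Lemma tensor_rectangle_sub T a b : tensor_sets T -> T (a, b) ->
  closure [set a] `*` closure [set b] `<=` T.
Proof.
move=> [cT1 cT2] Tab [x y] [/= ax bY].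
have Txb : T (x, b) by exact: (closure1_sub (cT2 b) Tab ax).
exact: (closure1_sub (cT1 x) Txb bY).
Qed.

Lemma bottom_tensor : bottom (tensor_space A B) = cross.
Proof.
apply/seteqP; split; last by apply: cross_sub; exact: (@closure_closed (tensor_space A B)).
apply: bottom_sub.
rewrite (_ : cross = cross `|` bottom A `*` bottom B).
  by apply: tensor_rectangle; exact: closure_closed.
by apply/seteqP; split=> [p|p [//|[bp _]]]; left.
Qed.

Lemma closure_pair a b :
  closure ([set (a, b)] : set (tensor_space A B)) =
  cross `|` closure [set a] `*` closure [set b].
Proof.
have cab := @closure_closed (tensor_space A B) [set (a, b)].
apply/seteqP; split.
  apply: (@closure1_sub (tensor_space A B)).
    by apply: tensor_rectangle; exact: closure_closed.
  by right; split; exact: mem_closure1.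
rewrite subUset; split; first exact: cross_sub.
by apply: tensor_rectangle_sub => //; exact: (@mem_closure1 (tensor_space A B)).
Qed.

(** For the direct implication, points outside the bottoms in the intersections
    of the two pairs of closures would form a pair lying in both rectangles and
    off the cross. *)
Lemma perp_tensor a b x y :
  @perp (tensor_space A B) (a, b) (x, y) <-> perp a x \/ perp b y.
Proof.
rewrite perpE !closure_pair bottom_tensor !perpE; split=> [abxy|].
  have [|nax] := pselect (closure [set a] `&` closure [set x] `<=` bottom A).
    by left.
  right=> w [bw yw]; apply: contrapT => nw; apply: nax => z [az xz].
  by have [] : cross (z, w) by apply: abxy; split; right.
move=> abxy [z w] [[//|[/= az bw]] [//|[/= xz yw]]].
by case: abxy => [/(_ z)|/(_ w)] H; [left|right]; exact: H.
Qed.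

End TensorPerp.

Lemma polarized_tensor (A B : closureSpace) :
  polarized A -> polarized B -> polarized (tensor_space A B).
Proof.
move=> pA pB [a b]; split=> [x|y].
  have [ax|nax] := pselect (perp a x).
    rewrite (_ : mkset _ = setT); first exact: closed_setT.
    by apply/seteqP; split=> // y _; apply/perp_tensor; left.
  rewrite (_ : mkset _ = perp b); first exact: pB.
  apply/seteqP; split=> [y /perp_tensor[]//|y bY].
  by apply/perp_tensor; right.
have [bY|nby] := pselect (perp b y).
  rewrite (_ : mkset _ = setT); first exact: closed_setT.
  by apply/seteqP; split=> // x _; apply/perp_tensor; right.
rewrite (_ : mkset _ = perp a); first exact: pA.
apply/seteqP; split=> [x /perp_tensor[]//|x ax].
by apply/perp_tensor; left.
Qed.

(** Fixing a second coordinate [b] outside the bottom makes the alternative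
    [perp b b] impossible, so that the slice at [b] of the perp of [(a, b)] is
    the perp of [a]. *)
Lemma polarized_tensor_left (A B : closureSpace) :
  ~ one_closed_set B -> polarized (tensor_space A B) -> polarized A.
Proof.
move=> nB pAB a.
have [b nb] : exists b, ~ bottom B b.
  apply: contrapT => Nb; apply/nB/one_closed_setE/seteqP; split=> // b _.
  by apply: contrapT => nb; apply: Nb; exists b.
have [_ /(_ b)] := pAB (a, b); rewrite (_ : mkset _ = perp a) //.
apply/seteqP; split=> [x /perp_tensor[//|/perpxx //]|x ax].
by apply/perp_tensor; left.
Qed.

Lemma polarized_tensor_right (A B : closureSpace) :
  ~ one_closed_set A -> polarized (tensor_space A B) -> polarized B.
Proof.
move=> nA pAB b.
have [a na] : exists a, ~ bottom A a.
  apply: contrapT => Na; apply/nA/one_closed_setE/seteqP; split=> // a _.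
  by apply: contrapT => na; apply: Na; exists a.
have [/(_ a) + _] := pAB (a, b); rewrite (_ : mkset _ = perp b) //.
apply/seteqP; split=> [x /perp_tensor[/perpxx //|//]|x ax].
by apply/perp_tensor; right.
Qed.

Lemma polarized_tensorE (A B : closureSpace) :
  polarized (tensor_space A B) <->
  (polarized A /\ polarized B) \/ one_closed_set A \/ one_closed_set B.
Proof.
split=> [pAB|].
  have [|nA] := pselect (one_closed_set A); first by right; left.
  have [|nB] := pselect (one_closed_set B); first by right; right.
  left; split; first exact: (polarized_tensor_left nB pAB).
  exact: (polarized_tensor_right nA pAB).
case=> [[pA pB]|AB1]; first exact: polarized_tensor.
move=> p; rewrite (_ : perp p = setT); first exact: closed_setT.
apply/seteqP; split=> // q _; apply/perpE => -[x y] _; rewrite bottom_tensor.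
by case: AB1 => /one_closed_setE b1; [left|right]; rewrite /= b1.
Qed.

(** * The isomorphisms *)

Section CheckTensor.
Variables A B : closureSpace.

Definition tensor_restrict (T : set (A * B)) : set (check A * check B) :=
  [set p | T (val p.1, val p.2)].

(** The universal quantification puts the whole cross into the extension. *)
Definition tensor_extend (T : set (check A * check B)) : set (A * B) :=
  [set p | forall (x : check A) (y : check B),
    val x = p.1 -> val y = p.2 -> T (x, y)].

Lemma not_bottom_val (C : closureSpace) (x : check C) : ~ bottom C (val x).
Proof. exact: set_mem (valP x). Qed.

Lemma check_val_inj (C : closureSpace) (x y : check C) : val x = val y -> x = y.
Proof. exact: val_inj. Qed.

Lemma check_lift (C : closureSpace) (x : C) :
  ~ bottom C x -> exists x' : check C, val x' = x.
Proof. by move=> nx; exists (exist _ x (mem_set nx)). Qed.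

Lemma tensor_restrict_closed T : tensor_sets T ->
  tensor_sets (tensor_restrict T).
Proof.
move=> [cT1 cT2]; split=> [x|y].
  by exists [set y | T (val x, y)].
by exists [set x | T (x, val y)].
Qed.

(** A slice of [T] outside the bottom is the trace of a closed set [C], and the
    slice of the extension is [C] itself because [C] contains the bottom. *)
Lemma tensor_extend_closed T : tensor_sets T -> tensor_sets (tensor_extend T).
Proof.
move=> [cT1 cT2]; split=> [x|y].
  have [bx|/check_lift[x' <-]] := pselect (bottom A x).
    rewrite (_ : mkset _ = setT); first exact: closed_setT.
    apply/seteqP; split=> // y _ x' y' xx' _.
    by case: (@not_bottom_val _ x'); rewrite xx'.
  have [C cC TC] := cT1 x'; rewrite (_ : mkset _ = C) //.
  apply/seteqP; split=> [y Ty|y Cy x0 y0 /check_val_inj -> yy0].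
    have [|/check_lift[y' yy']] := pselect (bottom B y).
      exact: bottom_sub.
    have : [set y0 | T (x', y0)] y' by exact: (Ty x' y').
    by rewrite TC; rewrite -yy'.
  by rewrite -[T _]/([set y1 | T (x', y1)] y0) TC /preimage/= yy0.
have [bY|/check_lift[y' <-]] := pselect (bottom B y).
  rewrite (_ : mkset _ = setT); first exact: closed_setT.
  apply/seteqP; split=> // x _ x' y' _ yy'.
  by case: (@not_bottom_val _ y'); rewrite yy'.
have [C cC TC] := cT2 y'; rewrite (_ : mkset _ = C) //.
apply/seteqP; split=> [x Tx|x Cx x0 y0 xx0 /check_val_inj ->].
  have [|/check_lift[x' xx']] := pselect (bottom A x).
    exact: bottom_sub.
  have : [set x0 | T (x0, y')] x' by exact: (Tx x' y').
  by rewrite TC; rewrite -xx'.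
by rewrite -[T _]/([set x1 | T (x1, y')] x0) TC /preimage/= xx0.
Qed.

Lemma tensor_extendK T : tensor_restrict (tensor_extend T) = T.
Proof.
apply/seteqP; split=> [[x y] Txy|[x y] Txy x' y']; first exact: Txy.
by move=> /check_val_inj -> /check_val_inj ->.
Qed.

Lemma tensor_restrictK T : tensor_sets T ->
  tensor_extend (tensor_restrict T) = T.
Proof.
move=> cT; apply/seteqP; split=> [[x y] Txy|[x y] Txy x' y' xx' yy'];
  last by rewrite /tensor_restrict /mkset xx' yy'.
have [bx|/check_lift[x' xx']] := pselect (bottom A x).
  by apply: cross_sub => //; left.
have [bY|/check_lift[y' yy']] := pselect (bottom B y).
  by apply: cross_sub => //; right.
have : T (val x', val y') by exact: Txy.
by rewrite xx' yy'.
Qed.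

Lemma check_tensor_iso :
  lattice_iso (tensor (check A) (check B)) (tensor A B).
Proof.
pose f (T : tensor (check A) (check B)) : tensor A B :=
  @to_closed (tensor_space A B) _ (tensor_extend_closed (closed_latticeP T)).
pose g (T : tensor A B) : tensor (check A) (check B) :=
  @to_closed (tensor_space (check A) (check B)) _
    (tensor_restrict_closed (closed_latticeP T)).
apply: (@lattice_iso_cancel _ _ _ _ f g).
- by move=> T; apply: val_inj; exact: tensor_extendK.
- move=> T; apply: val_inj; exact: tensor_restrictK (closed_latticeP T).
- move=> S T; rewrite !closed_latticeE => ST p Sp x y xp yp.
  exact/ST/Sp.
- by move=> S T; rewrite !closed_latticeE => ST p; exact: ST.
Qed.

End CheckTensor.

Section ClosedSetTensor.
Variables A B : closureSpace.
Local Notation CA := (closed_lattice A).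
Local Notation CB := (closed_lattice B).
Local Notation ideal_tensor_sets :=
  (@tensor_sets (ideal_space CA) (ideal_space CB)).

Definition rectangles (T : set (A * B)) : set (CA * CB) :=
  [set P | val P.1 `*` val P.2 `<=` T].

Definition closure_pairs (U : set (CA * CB)) : set (A * B) :=
  [set p | U (closed_closure [set p.1], closed_closure [set p.2])].

Lemma closed_closure1_le (C : closureSpace) (x : C) (F : closed_lattice C) :
  (closed_closure [set x] <= F)%O <-> val F x.
Proof.
rewrite closed_latticeE; split=> [|Fx]; first by apply; exact: mem_closure1.
by apply: closure1_sub => //; exact: closed_latticeP.
Qed.

Lemma closed_closure1_slice (C : closureSpace) (D : set (closed_lattice C)) :
  principal_ideals D -> closed_sets C [set x | D (closed_closure [set x])].
Proof.
move=> [F ->]; rewrite (_ : mkset _ = val F); first exact: closed_latticeP.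
by apply/seteqP; split=> x /closed_closure1_le.
Qed.

(** A closed set is the join of the closures of its points, and principal
    ideals are the down-sets that are stable under all joins.  This is what
    turns membership of a pair of closed sets in a tensor into a condition on
    the points, one coordinate at a time. *)
Lemma ideal_of_points (C : closureSpace) (D : set (closed_lattice C)) F :
  principal_ideals D -> D F <-> val F `<=` [set x | D (closed_closure [set x])].
Proof.
move=> [G ->] /=; rewrite closed_latticeE.
by split=> FG x /FG /closed_closure1_le.
Qed.

Lemma rectangles_closed T : tensor_sets T -> ideal_tensor_sets (rectangles T).
Proof.
move=> [cT1 cT2]; split=> [F|G].
  have cI : closed_sets B
      (\bigcap_(Y in [set [set y | T (x, y)] | x in val F]) Y).
    by apply: closed_bigcap => _ [x _ <-]; exact: cT1.
  exists (to_closed cI); apply/seteqP; split=> G /=; rewrite closed_latticeE.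
    by move=> FG y Gy _ [x Fx <-]; exact: FG.
  by move=> GI [x y] [/= Fx Gy]; apply: (GI y Gy [set y | T (x, y)]); exists x.
have cI : closed_sets A
    (\bigcap_(X in [set [set x | T (x, y)] | y in val G]) X).
  by apply: closed_bigcap => _ [y _ <-]; exact: cT2.
exists (to_closed cI); apply/seteqP; split=> F /=; rewrite closed_latticeE.
  by move=> FG x Fx _ [y Gy <-]; exact: FG.
by move=> FI [x y] [/= Fx Gy]; apply: (FI x Fx [set x | T (x, y)]); exists y.
Qed.

Lemma closure_pairs_closed U : ideal_tensor_sets U ->
  tensor_sets (closure_pairs U).
Proof.
move=> [cU1 cU2]; split=> [x|y].
  exact: (@closed_closure1_slice B _ (cU1 (closed_closure [set x]))).
exact: (@closed_closure1_slice A _ (cU2 (closed_closure [set y]))).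
Qed.

Lemma rectanglesK T : tensor_sets T -> closure_pairs (rectangles T) = T.
Proof.
move=> cT; apply/seteqP; split=> -[x y].
  by apply; split; exact: mem_closure1.
exact: tensor_rectangle_sub.
Qed.

Lemma closure_pairsK U : ideal_tensor_sets U ->
  rectangles (closure_pairs U) = U.
Proof.
move=> [cU1 cU2]; apply/seteqP; split=> -[F G].
  move=> FG; apply/(ideal_of_points F (cU2 G)) => x Fx /=.
  by apply/(ideal_of_points G (cU1 _)) => y Gy; exact: (FG (x, y)).
move=> UFG [x y] [/= Fx Gy].
have UxG : U (closed_closure [set x], G).
  exact: ((ideal_of_points F (cU2 G)).1 UFG).
exact: ((ideal_of_points G (cU1 _)).1 UxG).
Qed.

Lemma closed_tensor_iso :
  lattice_iso (tensor A B) (tensor (ideal_space CA) (ideal_space CB)).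
Proof.
pose f (T : tensor A B) : tensor (ideal_space CA) (ideal_space CB) :=
  @to_closed (tensor_space (ideal_space CA) (ideal_space CB)) _
    (rectangles_closed (closed_latticeP T)).
pose g (U : tensor (ideal_space CA) (ideal_space CB)) : tensor A B :=
  @to_closed (tensor_space A B) _ (closure_pairs_closed (closed_latticeP U)).
apply: (@lattice_iso_cancel _ _ _ _ f g).
- by move=> T; apply: val_inj; exact: rectanglesK (closed_latticeP T).
- by move=> U; apply: val_inj; exact: closure_pairsK (closed_latticeP U).
- by move=> S T; rewrite !closed_latticeE => ST P SP p /SP; exact: ST.
- by move=> U V; rewrite !closed_latticeE => UV p; exact: UV.
Qed.

End ClosedSetTensor.

(** * Pseudocomplemented tensor products *)

Theorem theorem7p1 (A B : closureSpace) :
  let CA : completeLatticeType set_display := closed_lattice A in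
  let CB : completeLatticeType set_display := closed_lattice B in
  let checkAB := tensor (check A) (check B) in
  let AB := tensor A B in
  let CACB := tensor (ideal_space CA) (ideal_space CB) in
  (lattice_iso checkAB AB /\ lattice_iso AB CACB) /\
  [<-> (polarized A /\ polarized B) \/ one_closed_set A \/ one_closed_set B;
       (pseudocomplemented CA /\ pseudocomplemented CB) \/
       is_singleton CA \/ is_singleton CB;
       [/\ pseudocomplemented checkAB,
           pseudocomplemented AB &
           pseudocomplemented CACB]].
Proof.
move=> CA CB checkAB AB CACB.
have iso1 : lattice_iso checkAB AB by exact: check_tensor_iso.
have iso2 : lattice_iso AB CACB by exact: closed_tensor_iso.
split; first by split.
have pABE : pseudocomplemented AB <->
    (polarized A /\ polarized B) \/ one_closed_set A \/ one_closed_set B.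
  by rewrite -polarized_tensorE; exact: pseudocomplemented_closed_lattice.
tfae.
- by rewrite !pseudocomplemented_closed_lattice !is_singleton_closed_lattice.
- rewrite !pseudocomplemented_closed_lattice !is_singleton_closed_lattice.
  move=> /pABE pAB; split=> //; last exact: pseudocomplemented_iso pAB.
  exact: pseudocomplemented_iso (lattice_iso_sym iso1) pAB.
- by case=> _ /pABE.
Qed.
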